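(* Let $\mathbf{f}\colon\mathbb{R}^n\to\mathbb{R}^n$ be a polynomial vector field, let $\mathcal{X}_0,\mathcal{X}_u\subseteq\mathbb{R}^n$, and let $B\in\mathbb{R}[\mathbf{x}]$. If $B$ is an invariant barrier certificate of $\dot{\mathbf{x}}=\mathbf{f}(\mathbf{x})$ with respect to $\mathcal{X}_0$ and $\mathcal{X}_u$, then $\Psi=\{\mathbf{x}\mid B(\mathbf{x})\le 0\}$ is an inductive invariant of the system. Conversely, if $\Psi=\{\mathbf{x}\mid B(\mathbf{x})\le 0\}$ is an inductive invariant of the system satisfying $\mathcal{X}_0\subseteq\Psi$ and $\Psi\cap\mathcal{X}_u=\emptyset$, then $B$ is an invariant barrier certificate of the system with respect to $\mathcal{X}_0$ and $\mathcal{X}_u$.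
   Context: Consider the autonomous system $\dot{\mathbf{x}}=\mathbf{f}(\mathbf{x})$ with $\mathbf{f}$ polynomial. For $\mathbf{x}_0\in\mathbb{R}^n$, $\boldsymbol{\zeta}_{\mathbf{x}_0}\colon[0,T)\to\mathbb{R}^n$ denotes the unique solution with $\boldsymbol{\zeta}_{\mathbf{x}_0}(0)=\mathbf{x}_0$, defined on its maximal interval of existence $[0,T)$, $T\in\mathbb{R}^+\cup\{\infty\}$. A set $\Psi\subseteq\mathbb{R}^n$ is an inductive invariant iff for all $\mathbf{x}_0\in\Psi$ and all $t\in[0,T)$, $\boldsymbol{\zeta}_{\mathbf{x}_0}(t)\in\Psi$. The Lie derivatives of $B$ along $\mathbf{f}$ are $\mathcal{L}^0_{\mathbf{f}}B=B$ and $\mathcal{L}^k_{\mathbf{f}}B=\langle \nabla \mathcal{L}^{k-1}_{\mathbf{f}}B,\mathbf{f}\rangle$ for $k>0$. $N_{B,\mathbf{f}}\in\mathbb{N}^+$ denotes the completeness threshold: the minimal index $i$ such that $\mathcal{L}^{i+1}_{\mathbf{f}}B$ belongs to the polynomial ideal generated by $\mathcal{L}^0_{\mathbf{f}}B,\dots,\mathcal{L}^i_{\mathbf{f}}B$. A polynomial $B$ is an invariant barrier certificate (w.r.t. $\mathcal{X}_0,\mathcal{X}_u$) iff (initial) $B(\mathbf{x})\le 0$ for all $\mathbf{x}\in\mathcal{X}_0$; (consecution) for all $\mathbf{x}\in\mathbb{R}^n$ and all $1\le i\le N_{B,\mathbf{f}}$: if $\mathcal{L}^j_{\mathbf{f}}B(\mathbf{x})=0$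 for all $0\le j\le i-1$, then $\mathcal{L}^i_{\mathbf{f}}B(\mathbf{x})\le 0$; (separation) $B(\mathbf{x})>0$ for all $\mathbf{x}\in\mathcal{X}_u$. *)

(* Defs.v *)
From HB Require Import structures.
From mathcomp Require Import all_boot all_order all_algebra.
From mathcomp Require mpoly.

Set Implicit Arguments.
Unset Strict Implicit.
Unset Printing Implicit Defensive.

Module PolyDefs.
Import mpoly.
Import GRing.Theory.
Local Open Scope ring_scope.

Notation poly_n n R := (mpoly.mpoly n R).

Definition peval {R : comNzRingType} {n : nat} (p : poly_n n R) (x : 'rV[R]_n) : R :=
  mpoly.meval (fun i => x ord0 i) p.

Definition vfield (R : comNzRingType) (n : nat) := 'I_n -> poly_n n R.

Definition feval {R : comNzRingType} {n : nat} (f : vfield R n) (x : 'rV[R]_n)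
  : 'rV[R]_n := \row_(i < n) peval (f i) x.

Definition lie {R : comNzRingType} {n : nat} (f : vfield R n) (B : poly_n n R)
  : poly_n n R := \sum_(i < n) (mpoly.mderiv i B * f i).

Definition lie_n {R : comNzRingType} {n : nat} (f : vfield R n) (B : poly_n n R)
  (k : nat) : poly_n n R := iter k (lie f) B.

Definition lie_in_ideal {R : comNzRingType} {n : nat} (f : vfield R n)
  (B : poly_n n R) (i : nat) : Prop :=
  exists q : 'I_i.+1 -> poly_n n R,
    lie_n f B i.+1 = \sum_(j < i.+1) q j * lie_n f B j.

End PolyDefs.
Notation poly_n n R := (mpoly.mpoly n R).
Notation peval := PolyDefs.peval.
Notation vfield := PolyDefs.vfield.
Notation feval := PolyDefs.feval.
Notation lie := PolyDefs.lie.
Notation lie_n := PolyDefs.lie_n.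
Notation lie_in_ideal := PolyDefs.lie_in_ideal.

From mathcomp Require Import all_classical all_reals all_analysis.
Import Order.TTheory GRing.Theory Num.Theory.
Import numFieldNormedType.Exports.
Local Open Scope classical_set_scope.
Local Open Scope ring_scope.

(* Completeness threshold N_{B,f}: the minimal positive index i such that
   L^(i+1) B is in the ideal generated by L^0 B,...,L^i B (such an i always
   exists by Hilbert's basis theorem; 0 is a never-used default). *)
Definition threshold {R : realType} {n : nat} (f : vfield R n)
  (B : poly_n n R) : nat :=
  match pselect (exists i, `[< (1 <= i)%N /\ lie_in_ideal f B i >]) with
  | left H => ex_minn H
  | right _ => 0%N
  end.

Definition is_solution {R : realType} {n : nat} (f : vfield R n)
  (x0 : 'rV[R]_n) (T : \bar R) (zeta : R -> 'rV[R]_n) : Prop :=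
  (0 < T)%E /\ zeta 0 = x0 /\
  {within [set t : R | 0 <= t /\ (t%:E < T)%E], continuous zeta} /\
  (forall t : R, 0 < t -> (t%:E < T)%E ->
     derivable zeta t 1 /\ 'D_1 zeta t = feval f (zeta t)).

Definition is_maximal_solution {R : realType} {n : nat} (f : vfield R n)
  (x0 : 'rV[R]_n) (T : \bar R) (zeta : R -> 'rV[R]_n) : Prop :=
  is_solution f x0 T zeta /\
  (forall (T' : \bar R) (zeta' : R -> 'rV[R]_n),
      is_solution f x0 T' zeta' -> (T' <= T)%E).

Definition inductive_invariant {R : realType} {n : nat} (f : vfield R n)
  (Psi : set 'rV[R]_n) : Prop :=
  forall (x0 : 'rV[R]_n) (T : \bar R) (zeta : R -> 'rV[R]_n),
    x0 \in Psi -> is_maximal_solution f x0 T zeta ->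
    forall t : R, 0 <= t -> (t%:E < T)%E -> zeta t \in Psi.

Definition invariant_barrier_certificate {R : realType} {n : nat}
  (f : vfield R n) (X0 Xu : set 'rV[R]_n) (B : poly_n n R) : Prop :=
  (forall x, x \in X0 -> peval B x <= 0) /\
  (forall (x : 'rV[R]_n) (i : nat), (1 <= i <= threshold f B)%N ->
     (forall j : nat, (j <= i.-1)%N -> peval (lie_n f B j) x = 0) ->
     peval (lie_n f B i) x <= 0) /\
  (forall x, x \in Xu -> 0 < peval B x).

Definition sublevel0 {R : realType} {n : nat} (B : poly_n n R)
  : set 'rV[R]_n := [set x | peval B x <= 0].

(* Main.v *)
Require Import Defs.
From HB Require Import structures.
From mathcomp Require Import all_boot all_order all_algebra.
From mathcomp Require Import all_classical all_reals all_analysis.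
From mathcomp Require Import ring.
From mathcomp Require mpoly.
Import -(notations) mpoly.
Set Implicit Arguments.
Unset Strict Implicit.
Unset Printing Implicit Defensive.
Import Order.TTheory GRing.Theory Num.Theory.
Import numFieldNormedType.Exports.
Local Open Scope classical_set_scope.
Local Open Scope ring_scope.

(** The threshold N is a genuine index because polynomial rings over a field
    are noetherian. Write h_j(t) = L^j B(zeta(t)), so h_j' = h_(j+1).

    If a solution leaves {B <= 0}, let t be the last time at which h_0 <= 0.
    If h_0, ..., h_N all vanish at t then, L^(N+1) B being in the ideal of the
    L^j B, they solve a homogeneous linear system with bounded coefficients and
    vanish after t (Gronwall); otherwise the first non-zero h_i(t) is negative,
    and integrating i times makes h_0 negative just after t. Both contradict
    the choice of t. Conversely, if the first non-zero L^i B(x) is positive,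
    the same integration makes B positive along the maximal solution from x.

    Local solutions come from Picard iteration: as f is polynomial and the
    iteration starts at a constant, every iterate is a polynomial in time, so
    that integration is algebraic. *)

(** * Noetherianity of polynomial rings *)

Definition is_ideal (A : comNzRingType) (J : A -> Prop) : Prop :=
  [/\ J 0, forall x y, J x -> J y -> J (x + y) & forall a x, J x -> J (a * x)].

(** The generated ideal as the intersection of all ideals containing [P]: membership is proved or
    used by choosing an ideal [J], without handling finite sums. *)
Definition ideal_gen (A : comNzRingType) (P : A -> Prop) (x : A) : Prop :=
  forall J, is_ideal J -> (forall y, P y -> J y) -> J x.

(* Ascending chain condition for the chain of ideals (u 0, ..., u (m-1)). *)
Definition noetherian (A : comNzRingType) : Prop :=
  forall u : nat -> A, exists m,
    ideal_gen (fun y => exists2 j, (j < m)%N & y = u j) (u m).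

Lemma ideal_gen_ideal (A : comNzRingType) (P : A -> Prop) :
  is_ideal (ideal_gen P).
Proof.
split=> [J [J0 _ _] _//|x y gx gy J iJ PJ|a x gx J iJ PJ].
- by have [_ JD _] := iJ; apply: JD; [exact: gx|exact: gy].
- by have [_ _ JM] := iJ; apply: JM; exact: gx.
Qed.

Lemma ideal_gen_sub (A : comNzRingType) (P Q : A -> Prop) (x : A) :
  (forall y, P y -> ideal_gen Q y) -> ideal_gen P x -> ideal_gen Q x.
Proof. by move=> PQ; apply => //; exact: ideal_gen_ideal. Qed.

Lemma ideal_opp (A : comNzRingType) (J : A -> Prop) (x : A) :
  is_ideal J -> J x -> J (- x).
Proof. by move=> [_ _ JM] Jx; rewrite -mulN1r; exact: JM. Qed.

(** Either [u 0] is zero, and lies in the ideal generated by nothing, or it is a unit and generates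
    everything, [u 1] included. *)
Lemma field_noetherian (F : fieldType) : noetherian F.
Proof.
move=> u; have [u0|u0] := eqVneq (u 0%N) 0.
  by exists 0%N => J [J0 _ _] _; rewrite u0.
exists 1%N => J [_ _ JM] PJ; rewrite -(divfK u0 (u 1%N)).
by apply/JM/PJ; exists 0%N.
Qed.

(** The sequence is lifted through a section of [phi]; since the preimage of an ideal is an ideal, a
    membership upstairs descends to [B]. *)
Lemma surj_noetherian (A B : comNzRingType) (phi : {rmorphism A -> B}) :
  (forall y, exists x, phi x = y) -> noetherian A -> noetherian B.
Proof.
move=> /choice[g gK] nA u; have [m um] := nA (g \o u).
exists m => J [J0 JD JM] PJ; rewrite -(gK (u m)).
apply: (um (J \o phi)) => /=.
  split=> [|x y|a x] /=; rewrite ?rmorph0 ?rmorphD ?rmorphM //.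
  - exact: JD.
  - exact: JM.
by move=> _ [j jm ->]; rewrite /= gK; apply: PJ; exists j.
Qed.

(* Hilbert's argument: pick v k of least size in I outside (v 0, ..., v (k-1)).
   The leading coefficients of the v k eventually repeat modulo the previous
   ones, which lets one lower the size of some v m. *)
Lemma poly_noetherian (A : comNzRingType) : noetherian A -> noetherian {poly A}.
Proof.
move=> nA u; apply: contrapT => /forallNP uN.
pose below v m (y : {poly A}) := exists2 j : nat, (j < m)%N & y = v j.
(* The union of the increasing chain of ideals; it is an ideal because two members lie in a common
   stage. *)
pose I p := exists m, ideal_gen (below u m) p.
have below_mono v m k p : (m <= k)%N -> ideal_gen (below v m) p ->
    ideal_gen (below v k) p.
  move=> mk; apply: ideal_gen_sub => _ [j jm ->] J _; apply.
  by exists j => //; exact: leq_trans mk.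
have I_ideal : is_ideal I.
  split=> [|x y [m mx] [k ky]|a x [m mx]].
  - by exists 0%N; have [] := ideal_gen_ideal (below u 0%N).
  - exists (maxn m k); have [_ h _] := ideal_gen_ideal (below u (maxn m k)).
    by apply: h; [apply: below_mono mx|apply: below_mono ky];
      rewrite ?leq_maxl ?leq_maxr.
  - by exists m; have [_ _] := ideal_gen_ideal (below u m); apply.
pose minimal (s : seq {poly A}) p := [/\ I p, ~ ideal_gen (fun y => y \in s) p &
  forall q, I q -> ~ ideal_gen (fun y => y \in s) q -> (size p <= size q)%N].
have ex_minimal s : (forall y, y \in s -> I y) -> exists p, minimal s p.
  move=> sI.
  (* A finite list in [I] is absorbed by a single stage [M]; then [u M], which escapes that stage,
     shows that there is something to minimize over. *)
  have [M sM] : exists M, forall y, y \in s -> ideal_gen (below u M) y.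
    elim: s sI => [|y s IHs] sI; first by exists 0%N.
    have [|M sM] := IHs; first by move=> z zs; apply: sI; rewrite inE zs orbT.
    have [k yk] := sI y (mem_head _ _); exists (maxn M k) => z.
    rewrite inE => /orP[/eqP->|/sM zM].
      exact: below_mono (leq_maxr _ _) yk.
    exact: below_mono (leq_maxl _ _) zM.
  have : exists d, `[< exists p, [/\ I p, ~ ideal_gen (fun y => y \in s) p &
      size p = d] >].
    exists (size (u M)); apply/asboolP; exists (u M); split=> //.
      by exists M.+1 => J _; apply; exists M.
    by move=> /(ideal_gen_sub sM); exact: uN.
  move=> /ex_minnP[d /asboolP[p [Ip sp pd]] dmin].
  exists p; split=> // q Iq sq; rewrite pd; apply: dmin.
  by apply/asboolP; exists q.
have [pick pickP] : {pick & forall s, (forall y, y \in s -> I y) ->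
    minimal s (pick s)}.
  apply: (@choice _ _ (fun s p => (forall y, y \in s -> I y) -> minimal s p)) => s.
  have [sI|sI] := pselect (forall y, y \in s -> I y).
    by have [p ?] := ex_minimal s sI; exists p.
  by exists 0 => /sI.
pose L := fix L k := if k is k'.+1 then rcons (L k') (pick (L k')) else [::].
pose v k := pick (L k).
have LP k y : y \in L k <-> below v k y.
  elim: k y => [|k IHk] y /=; first by split=> // -[].
  rewrite mem_rcons inE; split.
    move=> /orP[/eqP->|/IHk[j jk ->]]; first by exists k.
    by exists j => //; exact: ltnW.
  move=> [j]; rewrite ltnS leq_eqVlt => /orP[/eqP-> ->|jk ->].
    by rewrite eqxx.
  by apply/orP; right; apply/IHk; exists j.
have LI k : forall y, y \in L k -> I y.
  elim: k => [//|k IHk] y /=; rewrite mem_rcons inE => /orP[/eqP->|/IHk//].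
  by have [] := pickP _ IHk.
have LE k p : ideal_gen (fun y => y \in L k) p <-> ideal_gen (below v k) p.
  by split; apply: ideal_gen_sub => y /LP ? J _; apply.
have [m vm] := nA (fun k => lead_coef (v k)).
have [Ivm vmN vmin] := pickP _ (LI m); rewrite -/(v m) in Ivm vmN vmin.
have vm0 : v m != 0.
  by apply/eqP => v0; apply: vmN; rewrite v0; have [] := ideal_gen_ideal
    (fun y => y \in L m).
(* The coefficients in the degree of v m of the elements of small size of
   (v 0, ..., v (m-1)) form an ideal, and it contains the lead_coef (v j). *)
pose J a := exists g, [/\ ideal_gen (below v m) g, (size g <= size (v m))%N &
  g`_(size (v m)).-1 = a].
have [|_ [j jm ->]|g [gm gs gl]] := vm J.
- have [g0 gD gM] := ideal_gen_ideal (below v m).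
  split=> [|x y [g [gg sg <-]] [h [gh sh <-]]|a x [g [gg sg <-]]].
  + by exists 0; rewrite size_poly0 coef0.
  + exists (g + h); rewrite coefD; split=> //; first exact: gD.
    by rewrite (leq_trans (size_polyD _ _))// geq_max sg.
  + exists (a%:P * g); rewrite coefCM; split=> //; first exact: gM.
    by rewrite mul_polyC (leq_trans (size_scale_leq _ _)).
- have [Ivj vjN vjmin] := pickP _ (LI j); rewrite -/(v j) in Ivj vjN vjmin.
  (* [v m] was already a candidate when [v j] was picked, so the sizes do not decrease. *)
  have sj : (size (v j) <= size (v m))%N.
    apply: vjmin => // /LE/below_mono-/(_ _ (ltnW jm))/LE; exact: vmN.
  have vj0 : v j != 0.
    by apply/eqP => v0; apply: vjN; rewrite v0; have [] := ideal_gen_ideal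
      (fun y => y \in L j).
  (* The power of ['X] lifts [v j] to the degree of [v m], so that its leading coefficient is read
     off there. *)
  exists ('X^(size (v m) - size (v j)) * v j); split.
  + have [_ _] := ideal_gen_ideal (below v m); apply.
    by move=> K _; apply; exists j.
  + rewrite mulrC size_mulXn//; first by rewrite subnK.
  + rewrite coefXnM lead_coefE.
    have -> : (size (v m)).-1 = (size (v m) - size (v j) + (size (v j)).-1)%N.
      move: sj (size_poly_gt0 (v j)); rewrite vj0.
      by case: (size (v j)) (size (v m)) => [//|a] [//|b] ab _; rewrite subSS subnK.
    by rewrite ltnNge leq_addr /= addKn.
- have gL : ideal_gen (fun y => y \in L m) g by apply/LE.
  have Lid := ideal_gen_ideal (fun y => y \in L m).
  (* [v m - g] is still in [I] and outside the ideal of [L m], so minimality forbids a smaller size;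
     but the top coefficients of [v m] and [g] cancel. *)
  have : (size (v m) <= size (v m - g)%R)%N.
    apply: vmin.
      have [_ ID _] := I_ideal; apply: ID => //; apply: ideal_opp => //.
      apply: gL => // y; exact: LI.
    move=> vmg; apply: vmN; rewrite -(subrK g (v m)).
    by have [_ LD _] := Lid; exact: LD.
  apply/negP; rewrite -ltnNge.
  have : (0 < size (v m))%N by rewrite size_poly_gt0.
  case E : (size (v m)) => [//|d] _; rewrite ltnS.
  apply/leq_sizeP => i; rewrite leq_eqVlt => /orP[/eqP<-|di].
    by rewrite coefB; move: gl; rewrite lead_coefE E /= => ->; rewrite subrr.
  by rewrite coefB !nth_default ?subrr// ?E// (leq_trans gs)// E.
Qed.

(** Monomials are products of powers of variables, so constants and variables generate the algebra.
    This reduces facts about evaluation to four short cases. *)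
Lemma mpoly_alg_ind (n : nat) (A : comNzRingType) (P : poly_n n A -> Prop) :
  (forall c, P (mpoly.mpolyC n c)) ->
  (forall i, P (mpoly.mpolyX A (mpoly.mnm1 i))) ->
  (forall p q, P p -> P q -> P (p + q)) ->
  (forall p q, P p -> P q -> P (p * q)) -> forall p, P p.
Proof.
move=> PC PX PD PM; elim/mpoly.mpolyind => [|c m p _ _ Pp].
  by rewrite -(mpoly.mpolyC0 n A).
apply: PD => //; rewrite -mpoly.mul_mpolyC mpoly.mpolyXE_id; apply: (PM) => //.
apply: (big_ind P) => [||i _]; first by rewrite -(mpoly.mpolyC1 n A).
  exact: PM.
elim: (m i) => [|k IHk]; first by rewrite expr0 -(mpoly.mpolyC1 n A).
by rewrite exprS; apply: PM.
Qed.

(** Induction on the number of variables: univariate polynomials over [poly_n n F] map onto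
    [poly_n n.+1 F] by sending ['X] to the last variable. *)
Lemma mpoly_noetherian (F : fieldType) (n : nat) : noetherian (poly_n n F).
Proof.
elim: n => [|n IHn].
  pose phi : {rmorphism F -> (poly_n 0 F)} := mpoly.mpolyC 0 (R := F).
  refine (@surj_noetherian _ _ phi _ (@field_noetherian F)).
  elim/mpoly_alg_ind => [c|[]//|_ _ [x <-] [y <-]|_ _ [x <-] [y <-]].
  - by exists c.
  - by exists (x + y); rewrite rmorphD.
  - by exists (x * y); rewrite rmorphM.
pose X : poly_n n.+1 F := mpoly.mpolyX F (mpoly.mnm1 ord_max).
pose phi : {rmorphism {poly (poly_n n F)} -> (poly_n n.+1 F)} :=
  horner_eval X \o map_poly (@mpoly.mwiden n F).
apply: (@surj_noetherian _ _ phi) (poly_noetherian IHn).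
elim/mpoly_alg_ind => [c|i|_ _ [x <-] [y <-]|_ _ [x <-] [y <-]].
- exists (mpoly.mpolyC n c)%:P; rewrite /phi /= map_polyC /horner_eval hornerC.
  exact: mpoly.mwidenC.
- case: (unliftP ord_max i) => [j|] ->.
    exists (mpoly.mpolyX F (mpoly.mnm1 j))%:P.
    rewrite /phi /= map_polyC /horner_eval hornerC /= mpoly.mwidenX mpoly.mnmwiden1.
    by congr (mpoly.mpolyX F (mpoly.mnm1 _)); apply/val_inj; rewrite /= /bump leqNgt ltn_ord.
  by exists 'X; rewrite /phi /= map_polyX /horner_eval hornerX.
- by exists (x + y); rewrite rmorphD.
- by exists (x * y); rewrite rmorphM.
Qed.

(** The linear combinations form an ideal containing the generators, hence are a legitimate choice
    of [J]. *)
Lemma ideal_genE (A : comNzRingType) (u : nat -> A) (m : nat) (x : A) :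
  ideal_gen (fun y => exists2 j, (j < m)%N & y = u j) x ->
  exists q : 'I_m -> A, x = \sum_(j < m) q j * u j.
Proof.
move=> /(_ (fun x => exists q : 'I_m -> A, x = \sum_(j < m) q j * u j)); apply.
  split=> [|_ _ [q ->] [r ->]|a _ [q ->]].
  - by exists (fun=> 0); rewrite big1// => j _; rewrite mul0r.
  - exists (fun j => q j + r j); rewrite -big_split /=.
    by apply: eq_bigr => j _; rewrite mulrDl.
  - by exists (fun j => a * q j); rewrite mulr_sumr; apply: eq_bigr => j _; rewrite mulrA.
move=> _ [j jm ->]; exists (fun k => (k == Ordinal jm)%:R).
rewrite (bigD1 (Ordinal jm)) //= eqxx mul1r big1 ?addr0// => k /negPf->.
by rewrite mul0r.
Qed.

(** Noetherianity rules out the default branch of [threshold]. *)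
Lemma thresholdP (R : realType) (n : nat) (f : vfield R n) (B : poly_n n R) :
  (1 <= threshold f B)%N /\ lie_in_ideal f B (threshold f B).
Proof.
rewrite /threshold; case: pselect => [H|]; first by case: ex_minnP => i /asboolP.
(* Shifting the sequence by two makes the resulting index [m.+1] positive even when [m] is 0. *)
case; have [m um] := @mpoly_noetherian R n (fun k => lie_n f B k.+2).
exists m.+1; apply/asboolP; split=> //; apply: ideal_genE.
apply: ideal_gen_sub um => _ [j jm ->] J _; apply.
by exists j.+2 => //; rewrite !ltnS.
Qed.

(** * Polynomials along curves and scalar differential inequalities *)

Lemma norm_coord_le (R : realType) (n : nat) (x : 'rV[R]_n) (i : 'I_n) :
  `|x ord0 i| <= `|x|.
Proof.
by rewrite [leRHS]/Num.Def.normr /= mx_normrE; exact: (le_bigmax _ _ (ord0, i)).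
Qed.

Lemma norm_row_le (R : realType) (n : nat) (x : 'rV[R]_n) (e : R) :
  0 <= e -> (forall i, `|x ord0 i| <= e) -> `|x| <= e.
Proof.
move=> e0 xe; rewrite [leLHS]/Num.Def.normr /= mx_normrE.
by apply: bigmax_le => // -[i j] _ /=; rewrite (ord1 i).
Qed.

Lemma norm_row_le_sum (R : realType) (n : nat) (x : 'rV[R]_n) :
  `|x| <= \sum_i `|x ord0 i|.
Proof.
apply: norm_row_le => [|i]; first exact: sumr_ge0.
by rewrite (bigD1 i) //= lerDl sumr_ge0.
Qed.

Lemma continuous_peval (R : realType) (n : nat) (p : poly_n n R) :
  continuous (peval p).
Proof.
move=> x; elim/mpoly_alg_ind: p => [c|i|p q cp cq|p q cp cq].
- have -> : peval (mpoly.mpolyC n c) = cst c.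
    by apply/funext => y; rewrite /PolyDefs.peval mpoly.mevalC.
  exact: cst_continuous.
- have -> : peval (mpoly.mpolyX R (mpoly.mnm1 i)) = (fun y => y ord0 i).
    by apply/funext => y; rewrite /PolyDefs.peval mpoly.mevalXU.
  exact: coord_continuous.
- have -> : peval (p + q) = peval p \+ peval q.
    by apply/funext => y; rewrite /PolyDefs.peval mpoly.mevalD.
  exact: continuousD.
- have -> : peval (p * q) = peval p \* peval q.
    by apply/funext => y; rewrite /PolyDefs.peval mpoly.mevalM.
  exact: continuousM.
Qed.

(** Bound and Lipschitz constant come together because the Lipschitz estimate of a product uses
    bounds on both factors. *)
Lemma peval_lipschitz (R : realType) (n : nat) (p : poly_n n R) (r : R) :
  exists2 C : R, 0 <= C & forall x y, `|x| <= r -> `|y| <= r ->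
    `|peval p x| <= C /\ `|peval p x - peval p y| <= C * `|x - y|.
Proof.
elim/mpoly_alg_ind: p => [c|i|p q [C C0 Cp] [D D0 Dq]|p q [C C0 Cp] [D D0 Dq]].
- exists `|c| => // x y _ _; rewrite /PolyDefs.peval !mpoly.mevalC subrr normr0.
  by split=> //; rewrite mulr_ge0.
- exists (1 + `|r|) => [|x y xr yr]; first by rewrite addr_ge0.
  rewrite /PolyDefs.peval !mpoly.mevalXU; split.
    rewrite (le_trans (norm_coord_le x i)) // (le_trans xr) //.
    by rewrite (le_trans (ler_norm r)) // lerDr.
  rewrite (@le_trans _ _ `|x - y|) ?ler_peMl ?lerDl //.
  by have := norm_coord_le (x - y) i; rewrite !mxE.
- exists (C + D) => [|x y xr yr]; first by rewrite addr_ge0.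
  have [px pxy] := Cp x y xr yr; have [qx qxy] := Dq x y xr yr.
  rewrite /PolyDefs.peval !mpoly.mevalD; split.
    by rewrite (le_trans (ler_normD _ _)) // lerD.
  by rewrite opprD addrACA mulrDl (le_trans (ler_normD _ _)) // lerD.
- exists (C * D + C * D) => [|x y xr yr]; first by rewrite addr_ge0 ?mulr_ge0.
  have [px pxy] := Cp x y xr yr; have [qx qxy] := Dq x y xr yr.
  have [py _] := Cp y x yr xr.
  rewrite /PolyDefs.peval !mpoly.mevalM -!/(PolyDefs.peval _ _); split.
    by rewrite normrM -[leLHS]addr0 lerD ?ler_pM ?mulr_ge0.
  have -> : peval p x * peval q x - peval p y * peval q y =
      (peval p x - peval p y) * peval q x + peval p y * (peval q x - peval q y).
    by rewrite mulrBl mulrBr addrA subrK.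
  rewrite [leRHS]mulrDl (le_trans (ler_normD _ _)) // !normrM lerD //.
    by rewrite mulrAC ler_pM.
  by rewrite -mulrA ler_pM.
Qed.

Lemma is_derive_peval (R : realType) (n : nat) (p : poly_n n R)
    (z : R -> 'rV[R]_n) (t : R) (v : 'rV[R]_n) :
  derivable z t 1 -> 'D_1 z t = v ->
  is_derive t 1 (fun s => peval p (z s))
    (\sum_i peval (mpoly.mderiv i p) (z t) * v ord0 i).
Proof.
move=> dz Dz; elim/mpoly_alg_ind: p => [c|i|p q dp dq|p q dp dq].
- have -> : (fun s => peval (mpoly.mpolyC n c) (z s)) = cst c.
    by apply/funext => y; rewrite /PolyDefs.peval mpoly.mevalC.
  rewrite big1; first exact: is_derive_cst.
  by move=> i _; rewrite mpoly.mderivC /PolyDefs.peval mpoly.meval0 mul0r.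
- have -> : (fun s => peval (mpoly.mpolyX R (mpoly.mnm1 i)) (z s)) =
      (fun s => z s ord0 i).
    by apply/funext => y; rewrite /PolyDefs.peval mpoly.mevalXU.
  apply: DeriveDef; first by move/derivable_mxP: dz; exact.
  have -> : 'D_1 (fun s => z s ord0 i) t = v ord0 i.
    by rewrite -Dz (derive_mx dz) mxE.
  rewrite (bigD1 i) //= big1 ?addr0 => [|j /negPf ji].
    rewrite mpoly.mderivX mpoly.mnm1E eqxx scale1r.
    have -> : mpoly.mnm_sub (mpoly.mnm1 i) (mpoly.mnm1 i) = mpoly.mnm0.
      by apply/mpoly.mnmP => j; rewrite mpoly.mnmBE subnn mpoly.mnm0E.
    by rewrite mpoly.mpolyX0 /PolyDefs.peval mpoly.meval1 mul1r.
  rewrite mpoly.mderivX mpoly.mnm1E eq_sym ji scale0r.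
  by rewrite /PolyDefs.peval mpoly.meval0 mul0r.
- have -> : (fun s => peval (p + q) (z s)) =
      (fun s => peval p (z s)) + (fun s => peval q (z s)).
    by apply/funext => y; rewrite /PolyDefs.peval mpoly.mevalD.
  apply: is_derive_eq; rewrite -big_split /=; apply: eq_bigr => i _.
  by rewrite mpoly.mderivD /PolyDefs.peval mpoly.mevalD mulrDl.
- have -> : (fun s => peval (p * q) (z s)) =
      (fun s => peval p (z s)) * (fun s => peval q (z s)).
    by apply/funext => y; rewrite /PolyDefs.peval mpoly.mevalM.
  apply: is_derive_eq; rewrite !scaler_sumr -big_split /=; apply: eq_bigr => i _.
  rewrite mpoly.mderivM /PolyDefs.peval mpoly.mevalD !mpoly.mevalM mulrDl addrC.
  by rewrite /GRing.scale /= !mulrA [X in X * _ + _]mulrC.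
Qed.

(** The chain rule along a solution, which turns Lie derivatives into time derivatives. *)
Lemma is_derive_peval_lie (R : realType) (n : nat) (f : vfield R n)
    (p : poly_n n R) (z : R -> 'rV[R]_n) (t : R) :
  derivable z t 1 /\ 'D_1 z t = feval f (z t) ->
  is_derive t 1 (fun s => peval p (z s)) (peval (lie f p) (z t)).
Proof.
move=> [dz Dz]; apply: is_derive_eq (is_derive_peval p dz Dz) _.
rewrite /PolyDefs.lie /PolyDefs.peval raddf_sum; apply: eq_bigr => i _.
rewrite mxE.
by rewrite [RHS]mpoly.mevalM.
Qed.

Lemma within_bounded (R : realType) (n : nat) (z : R -> 'rV[R]_n) (a b : R) :
  a <= b -> {within `[a, b], continuous z} ->
  exists r, forall t, t \in `[a, b] -> `|z t| <= r.
Proof.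
move=> ab cz; have [|c _ zc] := @EVT_max R (fun t => `|z t|) a b ab.
  by move=> t; apply: (continuous_comp (cz t)); exact: norm_continuous.
by exists `|z c|.
Qed.

Lemma within_peval (R : realType) (n : nat) (p : poly_n n R)
    (z : R -> 'rV[R]_n) (A : set R) :
  {within A, continuous z} -> {within A, continuous (fun t => peval p (z t))}.
Proof.
by move=> cz t; apply: (continuous_comp (cz t)); exact: continuous_peval.
Qed.

(** Serves both the linear system of the Lie derivatives and the difference of two solutions.
    Squares replace absolute values in order to be differentiable. *)
Lemma gronwall_eq0 (R : realType) (m : nat) (u du : 'I_m -> R -> R) (C a b : R) :
  a <= b -> 0 <= C ->
  (forall j, {within `[a, b], continuous (u j)}) ->
  (forall j t, t \in `]a, b[ -> is_derive t 1 (u j) (du j t)) ->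
  (forall j t, t \in `]a, b[ -> `|du j t| <= C * \sum_k `|u k t|) ->
  (forall j, u j a = 0) -> forall j, u j b = 0.
Proof.
move=> ab C0 cu Du duC ua j.
move: ab; rewrite le_eqVlt => /predU1P[<-//|ltab].
(* The function exp(-Kt) * sum_j u_j^2 has a non-positive derivative. *)
pose K := C * m%:R * 2.
pose E := \sum_j u j ^+ 2.
have EE t : E t = \sum_j u j t ^+ 2 by rewrite /E fct_sumE.
pose g := (fun t => expR (- K * t)) * E.
pose dE t := \sum_j 2 * (u j t * du j t).
have dg t : t \in `]a, b[ ->
    is_derive t 1 g (expR (- K * t) * (dE t - K * E t)).
  move=> tab; have ? j' := Du j' t tab.
  have ? : is_derive t 1 (fun t => - K * t) (- K).
    by apply: is_derive_eq; rewrite [LHS]mulr1.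
  apply: is_derive_eq.
  rewrite /dE EE /GRing.scale /= mulrDr; congr (_ + _).
    by congr (_ * _); apply: eq_bigr => i _; rewrite expr1 mulrA.
  by rewrite mulrCA mulrN [_ * K]mulrC.
have cg : {within `[a, b], continuous g}.
  have ceK : continuous (fun t => expR (- K * t)).
    move=> t; apply: (@continuous_comp _ _ _ (fun t => - K * t) expR).
      exact: mulrl_continuous.
    exact: continuous_expR.
  move=> t; apply: continuousM; first exact: continuous_subspaceT.
  rewrite /E; apply: (big_ind (fun h : R -> R => {within `[a, b], continuous h})).
  - by move=> ?; exact: cst_continuous.
  - by move=> h1 h2 c1 c2 s; apply: continuousD; [exact: c1|exact: c2].
  - by move=> i _ s; rewrite expr2; apply: continuousM; exact: cu.
have dE_le t : t \in `]a, b[ -> dE t <= K * E t.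
  move=> tab; rewrite /dE EE.
  (* Each product satisfies 2 |u_j| |u_k| <= u_j^2 + u_k^2; summing over the pairs (j, k) produces
     the factors [m] and 2 in [K]. *)
  have -> : K * (\sum_j u j t ^+ 2) =
      \sum_(j < m) \sum_(k < m) C * (u j t ^+ 2 + u k t ^+ 2).
    under [RHS]eq_bigr do rewrite -mulr_sumr big_split /= sumr_const card_ord.
    rewrite -mulr_sumr big_split /= sumr_const card_ord sumrMnl -mulr2n.
    by rewrite /K -!mulrA; congr (_ * _); rewrite !mulr_natl mulrnAC.
  apply: ler_sum => i _; rewrite -mulr_sumr.
  rewrite (le_trans (ler_norm _)) // !normrM ger0_norm //.
  rewrite (@le_trans _ _ (2 * (`|u i t| * (C * \sum_k `|u k t|)))) //.
    by rewrite ler_pM2l // ler_wpM2l // duC.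
  rewrite 2!(mulrCA _ C) ler_wpM2l // !mulr_sumr ler_sum // => k _.
  rewrite -[u i t ^+ 2]real_normK ?num_real // -[u k t ^+ 2]real_normK ?num_real //.
  rewrite -subr_ge0 mulr_natl addrAC -sqrrB; exact: sqr_ge0.
have gE t : g t = expR (- K * t) * E t by [].
have [c cab gba] := MVT ltab dg cg.
have : g b <= 0.
  have ga : g a = 0.
    by rewrite gE EE big1 ?mulr0 // => i _; rewrite ua expr0n.
  move: gba; rewrite ga subr0 => ->; rewrite pmulr_lle0 ?subr_gt0 //.
  by rewrite pmulr_rle0 ?expR_gt0 // subr_le0 dE_le.
rewrite gE pmulr_rle0 ?expR_gt0 // EE => Eb.
apply/eqP; rewrite -sqrf_eq0; apply/eqP.
have /psumr_eq0P : \sum_i u i b ^+ 2 = 0.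
  by apply/eqP; rewrite eq_le Eb sumr_ge0 // => i _; exact: sqr_ge0.
by move=> ->// i _; exact: sqr_ge0.
Qed.

(** Downward induction from [h i] to [h 0]: each function vanishes at [a] and has a positive
    derivative, so the mean value theorem makes it positive. *)
Lemma pos_of_derivs (R : realType) (h : nat -> R -> R) (i : nat) (a b : R) :
  (forall j, (j <= i)%N -> {within `[a, b], continuous (h j)}) ->
  (forall j t, (j < i)%N -> t \in `]a, b[ -> is_derive t 1 (h j) (h j.+1 t)) ->
  (forall j, (j < i)%N -> h j a = 0) ->
  (forall t, t \in `]a, b[ -> 0 < h i t) ->
  forall t, t \in `]a, b[ -> 0 < h 0%N t.
Proof.
move=> ch dh h0 hi; rewrite -(subnn i).
suff: forall k, (k <= i)%N -> forall t, t \in `]a, b[ -> 0 < h (i - k)%N t by apply.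
elim=> [|k IHk] ki t tab; first by rewrite subn0; exact: hi.
have ik : (i - k = (i - k.+1).+1)%N by rewrite subnS prednK // subn_gt0.
have lti : (i - k.+1 < i)%N by rewrite -ik leq_subr.
move: tab; rewrite in_itv /= => /andP[at_ tb].
have sub s : s \in `]a, t[ -> s \in `]a, b[.
  by rewrite !in_itv /= => /andP[-> /lt_trans->].
have cht : {within `[a, t], continuous (h (i - k.+1)%N)}.
  by apply: continuous_subspaceW (ch _ (ltnW lti)); apply: subset_itvl; exact: ltW.
have [s sat] := MVT at_ (fun s sat => dh (i - k.+1)%N s lti (sub s sat)) cht.
rewrite h0 // subr0 => ->; rewrite mulr_gt0 ?subr_gt0// -ik.
by apply: IHk (sub _ sat); exact: ltnW.
Qed.

Lemma within_dist_lt (R : realType) (A : set R) (h : R -> R) (t e : R) :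
  {within A, continuous h} -> A t -> 0 < e ->
  exists2 d, 0 < d & forall s, A s -> `|s - t| < d -> `|h s - h t| < e.
Proof.
move=> /subspace_continuousP/(_ t) ch At e0.
have /cvgrPdist_lt/(_ e e0) := ch At.
rewrite near_withinE => /nbhs_ballP[d /= d0 dP]; exists d => // s As st.
by rewrite distrC; apply: dP => //; rewrite /ball /= distrC.
Qed.

(** The time is the supremum of those where [h] is non-positive. By continuity, [h] positive there
    would contradict the supremum, and [h] negative the positivity just after. *)
Lemma last_nonpos (R : realType) (h : R -> R) (b : R) :
  0 <= b -> {within `[0, b], continuous h} -> h 0 <= 0 -> 0 < h b ->
  exists t, [/\ 0 <= t < b, h t = 0 & forall s, t < s <= b -> 0 < h s].
Proof.
move=> b0 ch h0 hb; pose S := [set t | 0 <= t <= b /\ h t <= 0].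
have S0 : S 0 by rewrite /S /= lexx b0.
have Sb : ubound S b by move=> t /= [/andP[]].
have hS : has_sup S by split; [exists 0|exists b].
pose t := sup S.
have t0 : 0 <= t by exact: (ub_le_sup hS.2).
have tb : t <= b by apply: ge_sup => //; exists 0.
have tpos s : t < s <= b -> 0 < h s.
  move=> /andP[ts sb]; rewrite ltNge; apply/negP => hs.
  move: (ts); rewrite ltNge => /negP; apply; apply: (ub_le_sup hS.2).
  by split=> //; rewrite sb (le_trans t0 (ltW ts)).
have At : `[0, b]%classic t by rewrite /= in_itv /= t0 tb.
have ht_le : h t <= 0.
  rewrite leNgt; apply/negP => ht.
  have [d d0 dP] := within_dist_lt ch At ht.
  have [s [/andP[s0 sb] hs] ts] := sup_adherent d0 hS.
  have st : s <= t by apply: (ub_le_sup hS.2); rewrite /S /= s0 sb hs.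
  have := dP s; rewrite /= in_itv /= s0 sb ler0_norm ?subr_le0 // opprB.
  rewrite ltrBlDr addrC -ltrBlDr => /(_ isT ts).
  rewrite ltr_norml => /andP[+ _]; rewrite ltrBrDl subrr ltNge.
  by rewrite hs.
have tltb : t < b by rewrite lt_neqAle tb andbT; apply: contraTneq hb => <-; rewrite -leNgt.
exists t; split=> //; first by rewrite t0.
apply/eqP; rewrite eq_le ht_le /= leNgt; apply/negP => ht.
have [|d d0 dP] := within_dist_lt ch At (e := - h t); first by rewrite oppr_gt0.
(* A time after [t], within the interval and closer to [t] than [d]. *)
pose s := Num.min b (t + d / 2).
have ts : t < s by rewrite lt_min tltb ltrDl divr_gt0.
have sb : s <= b by rewrite ge_min lexx.
have hs := tpos s; rewrite ts sb in hs.
have := dP s; rewrite /= in_itv /= sb (le_trans t0 (ltW ts)) => /(_ isT).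
rewrite gtr0_norm ?subr_gt0 // ltrBlDl => sd.
have : s < t + d.
  by rewrite gt_min ltrD2l ltr_pdivrMr // ltr_pMr // ltr1n orbT.
move=> /sd; rewrite ltr_norml => /andP[_]; rewrite ltrBlDr addNr.
by rewrite ltNge ltW // hs.
Qed.

(** * Signs of Lie derivatives along a solution *)

Lemma solution_within (R : realType) (n : nat) (f : vfield R n)
    (x0 : 'rV[R]_n) (T : \bar R) (z : R -> 'rV[R]_n) (a b : R) :
  is_solution f x0 T z -> 0 <= a -> (b%:E < T)%E ->
  {within `[a, b], continuous z}.
Proof.
move=> [_ [_ [cz _]]] a0 bT; apply: continuous_subspaceW cz => t /=.
rewrite in_itv /= => /andP[at_ tb]; split; first exact: le_trans at_.
by apply: le_lt_trans bT; rewrite lee_fin.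
Qed.

Lemma solution_is_derive (R : realType) (n : nat) (f : vfield R n)
    (x0 : 'rV[R]_n) (T : \bar R) (z : R -> 'rV[R]_n) (p : poly_n n R) (a b t : R) :
  is_solution f x0 T z -> 0 <= a -> (b%:E < T)%E -> t \in `]a, b[ ->
  is_derive t 1 (fun s => peval p (z s)) (peval (lie f p) (z t)).
Proof.
move=> [_ [_ [_ dz]]] a0 bT; rewrite in_itv /= => /andP[at_ tb].
apply: is_derive_peval_lie; apply: dz; first exact: le_lt_trans at_.
by apply: lt_trans bT; rewrite lte_fin.
Qed.

(** Continuity spreads the positivity of the [i]-th Lie derivative to a short interval, and
    [pos_of_derivs] brings it down to [B]. Used for [- B] in one direction of the theorem and for
    [B] in the other. *)
Lemma solution_pos_right (R : realType) (n : nat) (f : vfield R n)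
    (B : poly_n n R) (x0 : 'rV[R]_n) (T : \bar R) (z : R -> 'rV[R]_n)
    (i : nat) (a b : R) :
  is_solution f x0 T z -> 0 <= a -> a < b -> (b%:E < T)%E ->
  (forall j, (j < i)%N -> peval (lie_n f B j) (z a) = 0) ->
  0 < peval (lie_n f B i) (z a) ->
  exists2 c, a < c <= b & forall t, a < t < c -> 0 < peval B (z t).
Proof.
move=> sol a0 ab bT B0 Bi.
have cz := solution_within sol a0 bT.
have [d d0 dP] : exists2 d, 0 < d & forall s, `[a, b]%classic s -> `|s - a| < d ->
    `|peval (lie_n f B i) (z s) - peval (lie_n f B i) (z a)| < peval (lie_n f B i) (z a).
  have aab : `[a, b]%classic a by rewrite /= in_itv /= lexx ltW.
  exact: (@within_dist_lt R _ (fun s => peval (lie_n f B i) (z s)) a _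
    (within_peval cz) aab Bi).
pose c := Num.min b (a + d).
have ac : a < c by rewrite lt_min ab ltrDl.
have cb : c <= b by rewrite ge_min lexx.
have cT : (c%:E < T)%E by apply: le_lt_trans bT; rewrite lee_fin.
exists c; first by rewrite ac.
move=> t act; apply: (@pos_of_derivs _ (fun j t => peval (lie_n f B j) (z t)) i a c).
- by move=> j _; apply: within_peval; exact: solution_within sol a0 cT.
- by move=> j s ji sac; exact: solution_is_derive sol a0 cT sac.
- exact: B0.
- move=> s; rewrite in_itv /= => /andP[as_ sc].
  have := dP s; rewrite /= in_itv /= (ltW as_) (ltW (lt_le_trans sc cb)).
  rewrite gtr0_norm ?subr_gt0 // ltrBlDl => /(_ isT).
  move: (sc); rewrite lt_min => /andP[_ sd] /(_ sd).
  by rewrite ltr_norml => /andP[+ _]; rewrite ltrBrDl subrr.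
- by rewrite in_itv /=.
Qed.

Lemma lie_nN (R : realType) (n : nat) (f : vfield R n) (B : poly_n n R) (k : nat) :
  lie_n f (- B) k = - lie_n f B k.
Proof.
elim: k => [//|k IHk]; rewrite /PolyDefs.lie_n !iterS -!/(lie_n _ _ _) IHk.
rewrite /PolyDefs.lie -sumrN; apply: eq_bigr => i _.
by rewrite mpoly.mderivN mulNr.
Qed.

(** The Lie derivatives of order at most [N] satisfy a closed linear system: each has the next one
    as derivative, and the ideal relation closes the last row. Its coefficients are bounded on the
    compact arc, so [gronwall_eq0] applies. *)
Lemma solution_lie_eq0 (R : realType) (n : nat) (f : vfield R n)
    (B : poly_n n R) (x0 : 'rV[R]_n) (T : \bar R) (z : R -> 'rV[R]_n)
    (N : nat) (a b : R) :
  is_solution f x0 T z -> 0 <= a -> a <= b -> (b%:E < T)%E ->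
  lie_in_ideal f B N ->
  (forall j, (j <= N)%N -> peval (lie_n f B j) (z a) = 0) ->
  peval B (z b) = 0.
Proof.
move=> sol a0 ab bT [q lieq] B0.
have cz := solution_within sol a0 bT.
have [r zr] := within_bounded ab cz.
have [C C0 qC] : exists2 C : 'I_N.+1 -> R, forall j, 0 <= C j &
    forall j t, t \in `[a, b] -> `|peval (q j) (z t)| <= C j.
  have /choice[C CP] j : exists C : R, 0 <= C /\
      forall t, t \in `[a, b] -> `|peval (q j) (z t)| <= C.
    have [C C0 CP] := peval_lipschitz (q j) r; exists C; split=> // t tab.
    by have [] := CP _ _ (zr t tab) (zr t tab).
  by exists C => j; have [] := CP j.
(* The 1 accounts for the rows that shift the index, the sum for the last row. *)
pose D := 1 + \sum_j C j.
have D1 : 1 <= D by rewrite lerDl sumr_ge0.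
apply: (@gronwall_eq0 R N.+1 (fun j t => peval (lie_n f B j) (z t))
  (fun j t => peval (lie_n f B j.+1) (z t)) D a b ab _ _ _ _ _ ord0).
- exact: le_trans D1.
- by move=> j; exact: within_peval.
- by move=> j t tab; exact: solution_is_derive sol a0 bT tab.
- move=> j t tab; set S := \sum_k _.
  have leS (k : 'I_N.+1) : `|peval (lie_n f B k) (z t)| <= S.
    by rewrite /S (bigD1 k) //= lerDl sumr_ge0.
  have S0 : 0 <= S by exact: sumr_ge0.
  have [jN|] := ltnP j.+1 N.+1.
    by apply: le_trans (leS (Ordinal jN)) _; rewrite ler_peMl.
  rewrite ltnS => Nj; have -> : (j : nat) = N by apply/eqP; rewrite eqn_leq Nj -ltnS ltn_ord.
  rewrite lieq /PolyDefs.peval raddf_sum /=.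
  apply: le_trans (ler_norm_sum _ _ _) _.
  rewrite (@le_trans _ _ ((\sum_k C k) * S)) ?ler_wpM2r ?lerDr //.
  rewrite mulr_suml ler_sum // => k _.
  rewrite [X in `|X|]mpoly.mevalM normrM ler_pM //; last exact: leS.
  by apply: qC; move: tab; rewrite !in_itv /= => /andP[/ltW-> /ltW->].
- by move=> j; apply: B0; rewrite -ltnS.
Qed.

Lemma certificate_invariant (R : realType) (n : nat) (f : vfield R n)
    (B : poly_n n R) (x0 : 'rV[R]_n) (T : \bar R) (z : R -> 'rV[R]_n) (b : R) :
  (forall (x : 'rV[R]_n) (i : nat), (1 <= i <= threshold f B)%N ->
     (forall j : nat, (j <= i.-1)%N -> peval (lie_n f B j) x = 0) ->
     peval (lie_n f B i) x <= 0) ->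
  is_solution f x0 T z -> peval B x0 <= 0 -> 0 <= b -> (b%:E < T)%E ->
  peval B (z b) <= 0.
Proof.
move=> cons sol Bx0 b0 bT; rewrite leNgt; apply/negP => Bb.
have z0 : z 0 = x0 by have [_ []] := sol.
have [|t [/andP[t0 tb] Bt posB]] := last_nonpos b0
  (within_peval (p := B) (solution_within sol (lexx 0) bT)) _ Bb; first by rewrite z0.
have [_ thr] := thresholdP f B.
have [/forallP allz|] := boolP [forall j : 'I_(threshold f B).+1,
    peval (lie_n f B j) (z t) == 0].
  move: Bb; rewrite (solution_lie_eq0 sol t0 (ltW tb) bT thr) ?ltxx // => j jN.
  by apply/eqP; exact: (allz (Ordinal (jN : (j < _.+1)%N))).
rewrite negb_forall => /existsP[j0 j0P].
have : exists j, (j <= threshold f B)%N && (peval (lie_n f B j) (z t) != 0).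
  by exists j0; rewrite j0P -ltnS ltn_ord.
move=> /ex_minnP[i /andP[iN iP] imin].
have lt_i j : (j < i)%N -> peval (lie_n f B j) (z t) = 0.
  move=> ji; apply: contraTeq (ji) => jP; rewrite -leqNgt imin // jP andbT.
  by rewrite (leq_trans (ltnW ji)).
(* [B] vanishes at the exit time, so the first non-zero Lie derivative has positive order and falls
   under consecution. *)
have i0 : (0 < i)%N by case: i iP {iN imin lt_i} => // /eqP.
have Bi : peval (lie_n f B i) (z t) < 0.
  rewrite lt_neqAle iP cons ?i0 // => j ji; apply: lt_i.
  by rewrite -(prednK i0) ltnS.
(* For [- B] this makes [B] negative just after [t], where it is positive by the choice of [t]; the
   midpoint of [t] and [c] exhibits the clash. *)
have [||c /andP[tc cb] cP] := @solution_pos_right _ _ f (- B) _ _ _ i _ _ sol t0 tb bT.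
- by move=> j ji; rewrite lie_nN /PolyDefs.peval mpoly.mevalN [X in - X]lt_i ?oppr0.
- by rewrite lie_nN /PolyDefs.peval mpoly.mevalN oppr_gt0.
have [ts sc] := midf_lt tc; have := cP ((t + c) / 2).
rewrite ts sc /PolyDefs.peval mpoly.mevalN oppr_gt0 ltNge => /(_ isT) /negP; apply; apply/ltW/posB.
by rewrite ts (le_trans (ltW sc)).
Qed.

(** * Existence and uniqueness of solutions *)

Lemma poly_primitive (R : numFieldType) (p : {poly R}) :
  exists q : {poly R}, q^`() = p /\ q.[0] = 0.
Proof.
(* In degree 0 the coefficient is a division by zero, which is 0 by convention and gives the value
   at 0. *)
exists (\poly_(i < (size p).+1) (p`_i.-1 / i%:R)); split.
  apply/polyP => i; rewrite coef_deriv coef_poly ltnS.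
  have [ip|pi] := ltnP; last by rewrite mul0rn nth_default.
  by rewrite /= -[LHS]mulr_natr divfK // pnatr_eq0.
by rewrite horner_coef0 coef_poly /= invr0 mulr0.
Qed.

Lemma mpoly_comp_poly (R : comNzRingType) (n : nat) (p : poly_n n R)
    (phi : 'I_n -> {poly R}) :
  exists q : {poly R}, forall t, q.[t] = peval p (\row_i (phi i).[t]).
Proof.
elim/mpoly_alg_ind: p => [c|i|p q [P PE] [Q QE]|p q [P PE] [Q QE]].
- by exists c%:P => t; rewrite hornerC /PolyDefs.peval mpoly.mevalC.
- by exists (phi i) => t; rewrite /PolyDefs.peval mpoly.mevalXU mxE.
- by exists (P + Q) => t; rewrite hornerD PE QE /PolyDefs.peval mpoly.mevalD.
- by exists (P * Q) => t; rewrite hornerM PE QE /PolyDefs.peval mpoly.mevalM.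
Qed.

(** The Picard integral equation is recorded as an initial value and a derivative. The iterates,
    being polynomials in time, exist for all real times. *)
Lemma picard_iterates (R : realType) (n : nat) (f : vfield R n) (x0 : 'rV[R]_n) :
  exists w : nat -> R -> 'rV[R]_n, [/\ forall t, w 0%N t = x0,
    forall k, w k 0 = x0 &
    forall k i (t : R), is_derive t 1 (fun s => w k.+1 s ord0 i) (peval (f i) (w k t))].
Proof.
have /choice[step stepP] : forall phi : 'I_n -> {poly R},
    exists psi : 'I_n -> {poly R}, forall i, (psi i).[0] = x0 ord0 i /\
      forall t, (psi i)^`().[t] = peval (f i) (\row_j (phi j).[t]).
  move=> phi; have h i : exists q : {poly R}, q.[0] = x0 ord0 i /\
      forall t, q^`().[t] = peval (f i) (\row_j (phi j).[t]).
    have [p pE] := mpoly_comp_poly (f i) phi.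
    have [q [q' q0]] := poly_primitive p.
    exists ((x0 ord0 i)%:P + q); rewrite hornerD hornerC q0 addr0; split=> // t.
    by rewrite derivD derivC add0r q' pE.
  by have [psi] := choice h; exists psi.
pose phi k := iter k step (fun i => (x0 ord0 i)%:P).
exists (fun k t => \row_i (phi k i).[t]); split.
- by move=> t; apply/rowP => i; rewrite mxE hornerC.
- move=> [|k]; apply/rowP => i; rewrite mxE ?hornerC //=.
  by have [] := stepP (phi k) i.
- move=> k i t; rewrite -(stepP (phi k) i).2 -/(phi k.+1).
  have -> : (fun s => (\row_j (phi k.+1 j).[s]) ord0 i) = horner (phi k.+1 i).
    by apply/funext => s; rewrite mxE.
  exact: is_derive_poly.
Qed.

Lemma between_dist (R : realDomainType) (s t u : R) :
  Num.min s t <= u <= Num.max s t -> `|u - s| <= `|t - s|.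
Proof.
have [st|/ltW ts] := leP s t => /andP[h1 h2].
  by rewrite !ger0_norm ?subr_ge0 // lerB.
by rewrite !ler0_norm ?subr_le0 // lerN2 lerB.
Qed.

(** The endpoints may come in either order because the iterates are studied on both sides of time
    0. *)
Lemma mean_value_le (R : realType) (g dg : R -> R) (C s t : R) :
  (forall u : R, is_derive u 1 g (dg u)) ->
  (forall u, Num.min s t <= u <= Num.max s t -> `|dg u| <= C) ->
  `|g t - g s| <= C * `|t - s|.
Proof.
move=> Dg; wlog st : s t / s <= t.
  move=> h; have [|ts] := orP (le_total s t); first exact: h.
  by rewrite minC maxC => /(h _ _ ts); rewrite distrC [`|s - t|]distrC.
rewrite (min_idPl st) (max_idPr st) => dgC.
have cg : {within `[s, t], continuous g}.
  apply: continuous_subspaceT => u; apply: differentiable_continuous.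
  by apply/derivable1_diffP; have [] := Dg u.
have [c cst ->] := MVT_segment st (fun u _ => Dg u) cg.
by rewrite normrM ler_wpM2r // dgC.
Qed.

(* Lets the Picard iterates converge merely pointwise: a quadratic estimate
   survives the limit and still yields differentiability. *)
Lemma is_derive_of_quadratic (R : realType) (g : R -> R) (d t r K : R) :
  0 < r -> (forall s, `|s - t| < r -> `|g s - g t - (s - t) * d| <= K * `|s - t| ^+ 2) ->
  is_derive t 1 g d.
Proof.
move=> r0 gK.
have K0 : 0 <= K.
  have tr : t + r / 2 - t = r / 2 by rewrite addrC addKr.
  have rn : `|r / 2| = r / 2 by rewrite ger0_norm // divr_ge0 // ltW.
  have := gK (t + r / 2); rewrite tr rn.
  rewrite ltr_pdivrMr // ltr_pMr // ltr1n => /(_ isT) /(le_trans (normr_ge0 _)).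
  by rewrite pmulr_lge0 // exprn_gt0 // divr_gt0.
have lim : h^-1 *: (g (h *: 1 + t) - g t) @[h --> 0^'] --> d.
  apply/cvgrPdist_le => e e0; near=> h.
  have h0 : h != 0 by near: h; exact: nbhs_dnbhs_neq.
  have hr : `|h| < r by near: h; exact: dnbhs0_lt.
  (* [K + 1] keeps the divisor positive when [K] is 0. *)
  have he : `|h| < e / (K + 1).
    by near: h; apply: dnbhs0_lt; rewrite divr_gt0 // ltr_wpDl.
  have := gK (h + t); rewrite addrK => /(_ hr) hK.
  rewrite /GRing.scale /= mulr1 -[d](mulKf h0) -mulrBr normrM normfV.
  rewrite ler_pdivrMl ?normr_gt0 // distrC (le_trans hK) //.
  rewrite expr2 mulrA [leRHS]mulrC ler_wpM2r //.
  move: he; rewrite ltr_pdivlMr ?ltr_wpDl // => /ltW; apply: le_trans.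
  by rewrite mulrDr mulr1 mulrC lerDl.
apply: DeriveDef; first by apply/cvg_ex; exists d.
exact: cvg_lim lim.
Unshelve. all: by end_near. Qed.

Lemma cvg_row (R : realType) (n : nat) (T : Type) (F : set_system T) {FF : Filter F}
    (x : T -> 'rV[R]_n) (l : 'rV[R]_n) :
  (forall i, x t ord0 i @[t --> F] --> l ord0 i) -> x t @[t --> F] --> l.
Proof.
move=> xl; apply/cvgrPdist_le => e e0.
have : \forall t \near F, forall i, `|l ord0 i - x t ord0 i| <= e.
  by apply: filter_forall => i; have /cvgrPdist_le/(_ e e0) := xl i.
apply: filterS => t xt; apply: norm_row_le => [|i]; first exact: ltW.
by rewrite !mxE.
Qed.

(** The telescoping series is dominated by a convergent geometric one. *)
Lemma cvg_of_geometric (R : realType) (u : nat -> R) :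
  (forall k, `|u k.+1 - u k| <= 2^-1 ^+ k) -> cvgn u.
Proof.
move=> uk; have -> : u = (fun n => u 0%N + series (telescope u) n).
  by apply/funext => k; exact: eq_sum_telescope.
apply: is_cvgD; first exact: is_cvg_cst.
apply: normed_cvg; apply: series_le_cvg (is_cvg_geometric_series (a := 1) (z := 2^-1) _).
- by move=> k; exact: normr_ge0.
- by move=> k; rewrite /geometric /= mul1r exprn_ge0 // invr_ge0.
- by move=> k; rewrite /geometric /= mul1r; exact: uk.
- by rewrite ger0_norm ?invr_ge0 // invf_lt1 // ltr1n.
Qed.

Lemma local_solution (R : realType) (n : nat) (f : vfield R n) (x0 : 'rV[R]_n) :
  exists (h : R) (z : R -> 'rV[R]_n), 0 < h /\ is_solution f x0 h%:E z.
Proof.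
have [w [w0 wx0 Dw]] := picard_iterates f x0.
pose r := `|x0| + 1.
have [C C1 CP] : exists2 C, 1 <= C & forall i x y, `|x| <= r -> `|y| <= r ->
    `|peval (f i) x| <= C /\ `|peval (f i) x - peval (f i) y| <= C * `|x - y|.
  have /choice[c cP] i : exists c, 0 <= c /\ forall x y, `|x| <= r -> `|y| <= r ->
      `|peval (f i) x| <= c /\ `|peval (f i) x - peval (f i) y| <= c * `|x - y|.
    by have [c c0 cP] := peval_lipschitz (f i) r; exists c.
  exists (1 + \sum_i c i); first by rewrite lerDl sumr_ge0 // => i _; have [] := cP i.
  have le_c i : c i <= 1 + \sum_i c i.
    rewrite (bigD1 i) //= addrCA lerDl addr_ge0 // sumr_ge0 // => j _.
    by have [] := cP j.
  move=> i x y xr yr; have [_ /(_ x y xr yr)[cx cxy]] := cP i.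
  by rewrite (le_trans cx) // (le_trans cxy) // ler_wpM2r.
have C0 : 0 < C by exact: lt_le_trans C1.
(* With [C * h] equal to 1/2, the iterates stay within the margin 1 that [r] leaves around [x0], and
   each Picard step halves the distance between successive iterates. *)
pose h := (2 * C)^-1.
have h0 : 0 < h by rewrite invr_gt0 mulr_gt0.
have hC : C * h = 2^-1 by rewrite /h invfM mulrCA mulfV ?mulr1 // gt_eqF.
have between s t u : `|s| <= h -> `|t| <= h ->
    Num.min s t <= u <= Num.max s t -> `|u| <= h.
  rewrite !ler_norml => /andP[s1 s2] /andP[t1 t2] /andP[u1 u2]; apply/andP; split.
    by apply: le_trans u1; rewrite le_min s1.
  by apply: le_trans u2 _; rewrite ge_max s2.
have wr k t : `|t| <= h -> `|w k t| <= r.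
  elim: k t => [|k IHk] t th; first by rewrite w0 lerDl.
  rewrite -(subrK x0 (w k.+1 t)) addrC (le_trans (ler_normD _ _)) // lerD2l.
  apply: norm_row_le => // i; rewrite !mxE -{1}(wx0 k.+1).
  have h00 : `|0 : R| <= h by rewrite normr0 ltW.
  have wC : `|w k.+1 t ord0 i - w k.+1 0 ord0 i| <= C * `|t - 0|.
    apply: (@mean_value_le R (fun s => w k.+1 s ord0 i) _ C 0 t (Dw k i)) => u u0t.
    have uh := between _ _ _ h00 th u0t.
    by have [] := CP i _ _ (IHk u uh) (IHk u uh).
  rewrite (le_trans wC) // subr0.
  apply: (@le_trans _ _ (C * h)); first by rewrite ler_pM2l.
  by rewrite hC invf_le1 // ler1n.
have wlip k s t : `|s| <= h -> `|t| <= h -> `|w k t - w k s| <= C * `|t - s|.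
  move=> sh th; case: k => [|k]; first by rewrite !w0 subrr normr0 mulr_ge0 // ltW.
  apply: norm_row_le => [|i]; first by rewrite mulr_ge0 // ltW.
  rewrite !mxE; apply: (@mean_value_le R (fun s => w k.+1 s ord0 i) _ C s t (Dw k i)).
  move=> u /(between _ _ _ sh th) uh.
  by have [] := CP i _ _ (wr k u uh) (wr k u uh).
have wgeom k t : `|t| <= h -> `|w k.+1 t - w k t| <= 2^-1 ^+ k.
  have e0 m : 0 <= 2^-1 ^+ m :> R by rewrite exprn_ge0 // invr_ge0.
  elim: k t => [|k IHk] t th.
    rewrite w0 -(wx0 1%N) expr0.
    have h00 : `|0 : R| <= h by rewrite normr0 ltW.
    apply: le_trans (wlip 1%N 0 t h00 th) _; rewrite subr0.
    apply: (@le_trans _ _ (C * h)); first by rewrite ler_pM2l.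
    by rewrite hC invf_le1 // ler1n.
  apply: norm_row_le => // i; rewrite !mxE.
  have := @mean_value_le R (fun s => w k.+2 s ord0 i - w k.+1 s ord0 i)
    (fun u => peval (f i) (w k.+1 u) - peval (f i) (w k u)) (C * 2^-1 ^+ k) 0 t.
  rewrite !wx0 subrr !subr0 => /(_ (fun u => is_deriveB _ _)) kt.
  have {}kt := kt _; apply: (le_trans (kt _)).
    move=> u /between uh; have {}uh : `|u| <= h by apply: uh => //; rewrite normr0 ltW.
    have [_ /le_trans] := CP i _ _ (wr k.+1 u uh) (wr k u uh); apply.
    by rewrite ler_pM2l // IHk.
  by rewrite mulrAC exprS ler_wpM2r // -hC ler_pM2l.
have wcvg i t : `|t| <= h -> cvgn (fun k => w k t ord0 i).
  move=> th; apply: cvg_of_geometric => k.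
  by apply: le_trans (wgeom k t th); have := norm_coord_le (w k.+1 t - w k t) i; rewrite !mxE.
pose z t := \row_i limn (fun k => w k t ord0 i).
have wz t : `|t| <= h -> w k t @[k --> \oo] --> z t.
  by move=> th; apply: cvg_row => i; rewrite mxE; exact: wcvg.
have zquad i s t : `|s| <= h -> `|t| <= h ->
    `|z t ord0 i - z s ord0 i - (t - s) * peval (f i) (z s)| <= C * C * `|t - s| ^+ 2.
  move=> sh th.
  (* Once the linear term of slope [c] is subtracted, the derivative is a difference of values of
     [f i], at most [C * (C * |t - s|)] since [f i] is [C]-Lipschitz in space and [w k] in time. *)
  have wquad k : `|w k.+1 t ord0 i - w k.+1 s ord0 i - (t - s) * peval (f i) (w k s)|
      <= C * C * `|t - s| ^+ 2.
    pose c := peval (f i) (w k s).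
    have D (u : R) : is_derive u 1 (fun u => w k.+1 u ord0 i - c * u)
        (peval (f i) (w k u) - c).
      have ? := Dw k i u.
      by apply: is_derive_eq; rewrite [X in _ - X]mulr1.
    have kt := @mean_value_le R _ _ (C * (C * `|t - s|)) s t D.
    rewrite -/c; have -> : w k.+1 t ord0 i - w k.+1 s ord0 i - (t - s) * c =
        (w k.+1 t ord0 i - c * t) - (w k.+1 s ord0 i - c * s) by ring.
    rewrite expr2 mulrA -[C * C * _]mulrA.
    apply: kt => u stu; have uh := between _ _ _ sh th stu.
    have [_ /le_trans] := CP i _ _ (wr k u uh) (wr k s sh); apply.
    rewrite ler_pM2l // (le_trans (wlip k s u sh uh)) // ler_pM2l //.
    exact: between_dist.
  have lim : `|w k.+1 t ord0 i - w k.+1 s ord0 i - (t - s) * peval (f i) (w k s)|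
      @[k --> \oo] -->
      `|z t ord0 i - z s ord0 i - (t - s) * peval (f i) (z s)|.
    have wzi u : `|u| <= h -> w k.+1 u ord0 i @[k --> \oo] --> z u ord0 i.
      move=> uh; rewrite (cvg_shiftS (fun k => w k u ord0 i)) mxE; exact: wcvg.
    apply: cvg_norm; apply: cvgB; first by apply: cvgB; exact: wzi.
    apply: cvgM; first exact: cvg_cst.
    by apply: continuous_cvg (wz s sh); exact: continuous_peval.
  by apply: (ler_cvg_to lim (cvg_cst _)); exact: nearW.
exists h, z; split=> //; split; first by rewrite lte_fin.
(* This two-sided range contains 0, so differentiability also yields continuity at the left
   endpoint. *)
have Dz t : `|t| < h -> derivable z t 1 /\ 'D_1 z t = feval f (z t).
  move=> th.
  have Di i : is_derive t 1 (fun s => z s ord0 i) (peval (f i) (z t)).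
    apply: (@is_derive_of_quadratic R _ _ _ (h - `|t|) (C * C)); rewrite ?subr_gt0 // => s st.
    apply: zquad; first exact: ltW.
    rewrite -(subrK t s) (le_trans (ler_normD _ _)) // -lerBrDr; exact: ltW.
  have dz : derivable z t 1.
    by apply/derivable_mxP => i0 i; rewrite (ord1 i0); have [] := Di i.
  split=> //; rewrite (derive_mx dz); apply/matrixP => i0 i; rewrite !mxE (ord1 i0).
  by have [_] := Di i.
have pos_lt t : 0 <= t -> (t%:E < h%:E)%E -> `|t| < h by move=> t0; rewrite lte_fin ger0_norm.
split; [|split].
- apply/rowP => i; rewrite mxE; under [X in limn X]eq_fun do rewrite wx0.
  exact: lim_cst.
- apply: continuous_in_subspaceT => t; rewrite inE /= => -[t0 th].
  apply: differentiable_continuous; apply/derivable1_diffP.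
  by have [] := Dz t (pos_lt t t0 th).
- by move=> t t0 th; exact: Dz (pos_lt t (ltW t0) th).
Qed.

Lemma solution_coord (R : realType) (n : nat) (f : vfield R n)
    (z : R -> 'rV[R]_n) (t : R) (i : 'I_n) :
  derivable z t 1 /\ 'D_1 z t = feval f (z t) ->
  is_derive t 1 (fun s => z s ord0 i) (peval (f i) (z t)).
Proof.
move=> [dz Dz]; apply: DeriveDef; first by move/derivable_mxP: dz; exact.
have -> : peval (f i) (z t) = feval f (z t) ord0 i by rewrite mxE.
by rewrite -Dz (derive_mx dz) mxE.
Qed.

(** Both arcs lie in a ball on which [f] is Lipschitz, so the coordinates of the difference satisfy
    the hypotheses of [gronwall_eq0] with initial value zero. *)
Lemma solution_unique (R : realType) (n : nat) (f : vfield R n)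
    (x0 : 'rV[R]_n) (T T' : \bar R) (z z' : R -> 'rV[R]_n) (b : R) :
  is_solution f x0 T z -> is_solution f x0 T' z' ->
  0 <= b -> (b%:E < T)%E -> (b%:E < T')%E -> z b = z' b.
Proof.
move=> sol sol' b0 bT bT'.
have cz := solution_within sol (lexx 0) bT.
have cz' := solution_within sol' (lexx 0) bT'.
have [r zr] := within_bounded b0 cz; have [r' zr'] := within_bounded b0 cz'.
have [C C0 CP] : exists2 C : R, 0 <= C & forall i t, t \in `[0, b] ->
    `|peval (f i) (z t) - peval (f i) (z' t)| <= C * `|z t - z' t|.
  have /choice[c cP] i : exists c : R, 0 <= c /\ forall t, t \in `[0, b] ->
      `|peval (f i) (z t) - peval (f i) (z' t)| <= c * `|z t - z' t|.
    have [c c0 cP] := peval_lipschitz (f i) (Num.max r r'); exists c; split=> // t tb.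
    by have [] := cP (z t) (z' t); rewrite ?le_max ?zr ?zr' ?orbT.
  exists (\sum_i c i) => [|i t tb]; first by rewrite sumr_ge0 // => i _; have [] := cP i.
  have [_ /(_ t tb)/le_trans] := cP i; apply; rewrite ler_wpM2r //.
  by rewrite (bigD1 i) //= lerDl sumr_ge0 // => j _; have [] := cP j.
have z0 : z 0 = z' 0 by have [_ [-> _]] := sol; have [_ [-> _]] := sol'.
have oob t : t \in `]0, b[ -> 0 < t /\ t < b.
  by rewrite in_itv /= => /andP[].
apply/rowP => i; apply/eqP; rewrite -subr_eq0; apply/eqP.
apply: (@gronwall_eq0 R n (fun i t => z t ord0 i - z' t ord0 i)
  (fun i t => peval (f i) (z t) - peval (f i) (z' t)) C 0 b b0 C0).
- move=> j t; apply: continuousB.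
    exact: (continuous_comp (cz t) (@coord_continuous _ _ _ ord0 j (z t))).
  exact: (continuous_comp (cz' t) (@coord_continuous _ _ _ ord0 j (z' t))).
- move=> j t /oob[t0 tb]; have [_ [_ [_ dz]]] := sol; have [_ [_ [_ dz']]] := sol'.
  have tT : (t%:E < T)%E by apply: lt_trans bT; rewrite lte_fin.
  have tT' : (t%:E < T')%E by apply: lt_trans bT'; rewrite lte_fin.
  have ? := solution_coord j (dz t t0 tT); have ? := solution_coord j (dz' t t0 tT').
  exact: is_deriveB.
- move=> j t /oob[t0 tb]; apply: le_trans (CP j t _) _.
    by rewrite in_itv /= !ltW.
  rewrite ler_wpM2l // (le_trans (norm_row_le_sum _)) // ler_sum // => k _.
  by rewrite !mxE.
- by move=> j; rewrite z0 subrr.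
Qed.

(** * Gluing solutions into a maximal one *)

Lemma lt_ereal_between (R : realType) (t : R) (T : \bar R) :
  (t%:E < T)%E -> exists2 b, t < b & (b%:E < T)%E.
Proof.
case: T => [r|_|]; last by rewrite ltNge leNye.
  by rewrite lte_fin => tr; have [? ?] := midf_lt tr; exists ((t + r) / 2); rewrite ?lte_fin.
by exists (t + 1); rewrite ?ltrDl // ltry.
Qed.

(** The lifespan is the supremum of the lifespans of all solutions from [x0], so maximality is
    immediate. By uniqueness these solutions agree where they overlap and glue together;
    [local_solution] makes the supremum positive. *)
Lemma maximal_solution (R : realType) (n : nat) (f : vfield R n) (x0 : 'rV[R]_n) :
  exists T z, is_maximal_solution f x0 T z.
Proof.
pose S := [set T' | exists z', is_solution f x0 T' z'].
have [zeta zetaE] : {zeta & forall t T' z', is_solution f x0 T' z' -> 0 <= t ->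
    (t%:E < T')%E -> zeta t = z' t}.
  apply: (@choice _ _ (fun t v => forall T' z', is_solution f x0 T' z' -> 0 <= t ->
    (t%:E < T')%E -> v = z' t)) => t.
  have [[T [z [sol tT]]]|noT] := pselect (exists T' z', is_solution f x0 T' z' /\ (t%:E < T')%E).
    by exists (z t) => T' z' sol' t0 tT'; exact: solution_unique sol sol' t0 tT tT'.
  (* Beyond every lifespan the value is an arbitrary default. *)
  by exists x0 => T' z' sol' _ tT'; case: noT; exists T', z'.
have ltS t : (t%:E < ereal_sup S)%E -> exists T' z', is_solution f x0 T' z' /\ (t%:E < T')%E.
  by move=> /ereal_sup_gt[T' [z' sol'] tT']; exists T', z'.
have [h [z [h0 solz]]] := local_solution f x0.
exists (ereal_sup S), zeta; split; last first.
  by move=> T' z' sol'; apply: ereal_sup_ubound; exists z'.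
split; [|split; [|split]].
- apply: (@lt_le_trans _ _ h%:E); first by rewrite lte_fin.
  by apply: ereal_sup_ubound; exists z.
- have [_ [<- _]] := solz; apply: zetaE solz _ _ => //.
- apply/subspace_continuousP => t /= [t0 /ltS[T' [z' [sol' tT']]]].
  (* Room after [t] within the lifespan of [z'] makes [zeta] agree with [z'] at all non-negative
     times near [t]. *)
  have [b tb bT'] := lt_ereal_between tT'.
  have [_ [_ [/subspace_continuousP/(_ t (conj t0 tT')) cz' _]]] := sol'.
  apply/cvgrPdist_le => e e0.
  have /cvgrPdist_le/(_ e e0) := cz'; rewrite !near_withinE => cz'e.
  near=> s => -[s0 _].
  have sT' : (s%:E < T')%E.
    apply: lt_trans bT'; rewrite lte_fin; near: s; exact: lt_nbhsl.
  rewrite /from_subspace (zetaE s T' z') // (zetaE t T' z') //; move: (conj s0 sT').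
  by near: s; exact: cz'e.
- move=> t t0 /ltS[T' [z' [sol' tT']]].
  have [b tb bT'] := lt_ereal_between tT'.
  have near_eq : \forall s \near t, z' s = zeta s.
    near=> s; symmetry; apply: (zetaE s T' z') => //.
      by apply/ltW; near: s; exact: lt_nbhsr.
    by apply: lt_trans bT'; rewrite lte_fin; near: s; exact: lt_nbhsl.
  have [_ [_ [_ /(_ t t0 tT')[dz' Dz']]]] := sol'.
  split; first exact: near_eq_derivable dz'.
  by rewrite -(near_eq_derive _ near_eq) Dz' (zetaE t T' z') // ltW.
Unshelve. all: by end_near. Qed.

(** * Certificates and invariance of the sublevel set *)

Theorem theorem4 (R : realType) (n : nat) (f : vfield R n)
  (X0 Xu : set 'rV[R]_n) (B : poly_n n R) :
  (invariant_barrier_certificate f X0 Xu B ->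
     inductive_invariant f (sublevel0 B)) /\
  (inductive_invariant f (sublevel0 B) ->
     X0 `<=` sublevel0 B -> sublevel0 B `&` Xu = set0 ->
     invariant_barrier_certificate f X0 Xu B).
Proof.
split=> [[_ [cons _]] x0 T z|inv X0B XuB].
  rewrite !inE => Bx0 [sol _] t t0 tT; rewrite inE.
  exact: certificate_invariant cons sol Bx0 t0 tT.
split; [|split].
- by move=> x; rewrite inE => /X0B.
- move=> x i /andP[i1 _] Bj; rewrite leNgt; apply/negP => Bi.
  (* Invariance speaks only of maximal solutions, so one starting at [x] must be produced before
     [inv] can be contradicted. *)
  have [T [z max]] := maximal_solution f x.
  have [[T0 [z0 cz]] _] := max.
  (* As [i] is at least 1, the vanishing hypothesis covers order 0 and puts [x] in the sublevel
     set. *)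
  have Bx : peval B x <= 0 by rewrite (Bj 0%N).
  have [b b0 bT] := lt_ereal_between T0.
  have Bj0 j : (j < i)%N -> peval (lie_n f B j) (z 0) = 0.
    by move=> ji; rewrite z0 Bj // -ltnS prednK.
  rewrite -z0 in Bi.
  have [c /andP[c0 cb] cP] := solution_pos_right max.1 (lexx 0) b0 bT Bj0 Bi.
  have [h0 hc] := midf_lt c0; have := cP ((0 + c) / 2).
  rewrite h0 hc ltNge => /(_ isT)/negP; apply.
  have := inv x T z; rewrite !inE => /(_ Bx max ((0 + c) / 2)).
  rewrite inE; apply; first exact: ltW.
  by apply: lt_trans bT; rewrite lte_fin (lt_le_trans hc).
- move=> x; rewrite inE => xu; rewrite ltNge; apply/negP => Bx.
  by have : (sublevel0 B `&` Xu) x by []; rewrite XuB.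
Qed.
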